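(* Let $X$ be a complex Banach space, let $E \subset X'$ be a closed, almost norming vector subspace of the dual space $X'$, and let $T$ be a bounded linear operator on $X$. Let $f \in (c_0)_+$ and suppose that $f$ governs the sequence $(\langle x', T^n x\rangle)_{n \in \mathbb{N}_0}$ for all $x \in X$ and all $x' \in E$. Then the spectral radius of $T$ satisfies $r(T) < 1$.
   Context: $X'$ is the space of all bounded linear functionals on $X$. A vector subspace $E \subset X'$ is called almost norming if there is a constant $C > 0$ such that $\|x\| \le \sup_{x' \in E,\, \|x'\| \le 1} C\,|\langle x', x\rangle|$ for all $x \in X$. $c_0 = c_0(\mathbb{N}_0;\mathbb{C})$ is the space of complex sequences indexed by $\mathbb{N}_0$ that converge to $0$, and $(c_0)_+$ is the set of those $f \in c_0$ all of whose entries are real and non-negative. For $g = (g_n) \in c_0$, $|g| := (|g_n|)_{n \in \mathbb{N}_0}$. Inequalities between real sequences are understood entrywise. For $f \in (c_0)_+$, the principal ideal generated by $f$ is $(c_0)_f = \{g \in c_0 : \exists c \ge 0,\ |g| \le c f\}$. For $h = (h_n)_{n\in\mathbb{N}_0} \in (c_0)_+$, $h^* \in (c_0)_+$ denotes its non-increasing rearrangement: the sequence obtained by listing the entries of $h$ in non-increasing order with multiplicities; explicitly, $h^*_n = \inf\{t \ge 0 : \#\{k \in \mathbb{N}_0 : h_k > t\} \le n\}$ for $n \in \mathbb{N}_0$. A sequence $f \in (c_0)_+$ governs a complex sequence $a = (a_n)_{n \in \mathbb{N}_0}$ if $a \in c_0$ and the non-increasing rearrangement $|a|^*$ of $|a|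 = (|a_n|)_{n\in\mathbb{N}_0}$ belongs to $(c_0)_f$. *)

(* Defs.v *)
From Stdlib Require Import Reals List.
From Coquelicot Require Import Coquelicot.
Open Scope R_scope.

(** * Bounded linear functionals

    The dual [X'] of a complex normed space [X] consists of the functions
    [phi : X -> C] with [is_linear phi] (Coquelicot's [is_linear] means linear
    and bounded); a subset of [X'] is a predicate on [X -> C]. *)

Definition dual_norm {X : NormedModule C_AbsRing} (phi : X -> C) : Rbar :=
  Lub_Rbar (fun r => exists x : X, norm x <= 1 /\ r = Cmod (phi x)).

Record dual_subspace {X : NormedModule C_AbsRing} (E : (X -> C) -> Prop)
    : Prop := {
  dual_subspace_incl : forall phi, E phi -> is_linear phi;
  dual_subspace_zero : E (fun _ => RtoC 0);
  dual_subspace_plus : forall phi psi, E phi -> E psi ->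
    E (fun x => Cplus (phi x) (psi x));
  dual_subspace_scal : forall (c : C) phi, E phi ->
    E (fun x => Cmult c (phi x)) }.

(** Closed for the topology of the dual norm. *)
Definition dual_closed {X : NormedModule C_AbsRing} (E : (X -> C) -> Prop)
    : Prop :=
  forall phi : X -> C, is_linear phi ->
  (forall eps : posreal, exists psi, E psi /\
     Rbar_lt (dual_norm (fun x => Cminus (phi x) (psi x))) eps) ->
  E phi.

Definition almost_norming {X : NormedModule C_AbsRing} (E : (X -> C) -> Prop)
    : Prop :=
  exists K : R, 0 < K /\ forall x : X,
    Rbar_le (norm x)
      (Lub_Rbar (fun r => exists phi, E phi /\ Rbar_le (dual_norm phi) 1 /\
                          r = K * Cmod (phi x))).

(** * Spectrum and spectral radius of a bounded operator *)

Definition spectrum {X : NormedModule C_AbsRing} (T : X -> X) (lambda : C)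
    : Prop :=
  ~ exists S : X -> X, is_linear S /\
      (forall x, S (minus (scal lambda x) (T x)) = x) /\
      (forall x, minus (scal lambda (S x)) (T (S x)) = x).

(** On the zero space the spectrum is empty and this supremum is [m_infty]
    instead of the conventional [0]. *)
Definition spectral_radius {X : NormedModule C_AbsRing} (T : X -> X) : Rbar :=
  Lub_Rbar (fun r => exists lambda, spectrum T lambda /\ r = Cmod lambda).

(** * Null sequences, rearrangements and governing sequences *)

Definition c0 (a : nat -> C) : Prop := is_lim_seq (fun n => Cmod (a n)) 0.

Definition c0_nonneg (f : nat -> R) : Prop :=
  c0 (fun n => RtoC (f n)) /\ forall n, 0 <= f n.

Definition principal_ideal (f : nat -> R) (g : nat -> C) : Prop :=
  c0 g /\ exists c : R, 0 <= c /\ forall n, Cmod (g n) <= c * f n.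

Definition card_le (A : nat -> Prop) (n : nat) : Prop :=
  exists l : list nat, (length l <= n)%nat /\ forall k, A k -> In k l.

(** For [h] in [c0_nonneg] the set below is nonempty and bounded below, so the
    infimum is finite and [real] loses nothing. *)
Definition rearrangement (h : nat -> R) (n : nat) : R :=
  real (Glb_Rbar (fun t => 0 <= t /\ card_le (fun k => t < h k) n)).

Definition governs (f : nat -> R) (a : nat -> C) : Prop :=
  c0 a /\
  principal_ideal f
    (fun n => RtoC (rearrangement (fun k => Cmod (a k)) n)).

(* Main.v *)
Require Import Defs.
From Stdlib Require Import Reals Lra Lia List Classical.
From Stdlib Require Import ChoiceFacts IndefiniteDescription.
From Coquelicot Require Import Coquelicot.
Open Scope R_scope.

(** If [r(T) >= 1], there are approximate eigenvectors for values [l] with [|l|]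
    arbitrarily close to or above [1]: otherwise [l - T] would be uniformly
    bounded below on [|l| >= 1 - eps], so surjectivity would spread from large
    [|l|] to all of [|l| >= 1 - eps].  As [E] is almost norming, there is then
    [eta > 0] such that for every [N] some normalised [u] and [psi] in [E] satisfy
    [|psi (T^j u)| >= eta] for all [j <= N].

    A gliding hump turns this into one pair [(x, phi)] that [f] does not govern.
    Perturb [(x, phi)] to [(x +- a u, phi +- a psi)]: by polarization, for each
    [j <= 4 m] one of the four sign choices gives an orbit value of modulus at
    least [a^2 eta], so one of the choices is good for more than [m] indices.
    Since [a] is fixed before [m], the resulting lower bound on the [m]-th
    rearranged entry can be made to exceed [k f_m], and it survives all later,
    sufficiently small perturbations. *)

(** * Dependent choice and sequences that halve at every step *)

Lemma dependent_choice (A : Type) : FunctionalDependentChoice_on A.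
Proof.
  apply functional_choice_imp_functional_dependent_choice.
  exact functional_choice.
Qed.

Lemma halving_lt (d : nat -> R) :
  (forall k, d (S k) <= d k / 2) ->
  forall eps, 0 < eps -> exists k0, forall k, (k0 <= k)%nat -> d k < eps.
Proof.
  intros Hd eps Heps.
  assert (Hpow : forall k, d k <= d 0%nat * (/ 2) ^ k).
  { induction k as [|k IH]; simpl; [lra|]. specialize (Hd k). lra. }
  (* The added [1] keeps the denominator positive when [d 0] vanishes. *)
  destruct (pow_lt_1_zero (/ 2)) with (y := eps / (Rabs (d 0%nat) + 1)) as [k0 Hk0].
  { rewrite Rabs_pos_eq; lra. }
  { apply Rdiv_lt_0_compat; [lra|]. pose proof (Rabs_pos (d 0%nat)). lra. }
  exists k0. intros k Hk. specialize (Hk0 k Hk). specialize (Hpow k).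
  assert (0 < (/ 2) ^ k) by (apply pow_lt; lra).
  rewrite Rabs_pos_eq in Hk0 by lra.
  pose proof (Rabs_pos (d 0%nat)). pose proof (Rle_abs (d 0%nat)).
  apply Rmult_lt_compat_r with (r := Rabs (d 0%nat) + 1) in Hk0; [|lra].
  replace (eps / (Rabs (d 0%nat) + 1) * (Rabs (d 0%nat) + 1)) with eps in Hk0
    by (field; lra).
  nra.
Qed.

(** This turns an error estimate with geometric rate into an exact identity in the limit, once [a]
    is taken to be the norm of a difference. *)
Lemma halving_bound_le_0 (d : nat -> R) (a M : R) :
  (forall k, d (S k) <= d k / 2) -> 0 <= M ->
  (forall k, a <= M * d k) -> a <= 0.
Proof.
  intros Hd HM Ha.
  apply Rnot_lt_le. intros Hpos.
  destruct (halving_lt d Hd (a / (M + 1))) as [k Hk].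
  { apply Rdiv_lt_0_compat; lra. }
  specialize (Hk k (Nat.le_refl k)). specialize (Ha k).
  apply Rmult_lt_compat_r with (r := M + 1) in Hk; [|lra].
  replace (a / (M + 1) * (M + 1)) with a in Hk by (field; lra).
  nra.
Qed.

(** * Abelian group identities, norm estimates and completeness *)

Lemma minus_plus_distr {G : AbelianGroup} (x y z : G) :
  minus x (plus y z) = minus (minus x y) z.
Proof. unfold minus. now rewrite opp_plus, plus_assoc. Qed.

Lemma plus_minus_l {G : AbelianGroup} (x y : G) : minus (plus x y) x = y.
Proof.
  unfold minus. rewrite (plus_comm x), <- plus_assoc.
  exact (eq_trans (f_equal (plus y) (plus_opp_r x)) (plus_zero_r y)).
Qed.

Lemma minus_plus_cancel {G : AbelianGroup} (x y : G) : plus (minus x y) y = x.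
Proof.
  unfold minus. rewrite <- plus_assoc.
  exact (eq_trans (f_equal (plus x) (plus_opp_l y)) (plus_zero_r x)).
Qed.

Lemma minus_minus_r {G : AbelianGroup} (x y : G) : minus x (minus x y) = y.
Proof.
  refine (eq_trans (f_equal (plus x) (opp_minus x y)) _).
  rewrite plus_comm. apply minus_plus_cancel.
Qed.

Lemma minus_minus_cancel {G : AbelianGroup} (x y z : G) :
  minus (minus x z) (minus y z) = minus x y.
Proof.
  rewrite (minus_trans z x y), <- (opp_minus y z). reflexivity.
Qed.

Lemma norm_minus_diag {K : AbsRing} {V : NormedModule K} (x : V) :
  norm (minus x x) = 0.
Proof. exact (eq_trans (f_equal norm (minus_eq_zero x)) norm_zero). Qed.

Lemma norm_minus_sym {K : AbsRing} {V : NormedModule K} (x y : V) :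
  norm (minus x y) = norm (minus y x).
Proof. now rewrite <- opp_minus, norm_opp. Qed.

Lemma norm_minus_triangle {K : AbsRing} {V : NormedModule K} (y x z : V) :
  norm (minus x z) <= norm (minus x y) + norm (minus y z).
Proof. rewrite (minus_trans y x z). apply norm_triangle. Qed.

Lemma norm_le_minus {K : AbsRing} {V : NormedModule K} (x y : V) :
  norm x <= norm y + norm (minus x y).
Proof.
  rewrite <- (f_equal norm (minus_plus_cancel x y)), Rplus_comm.
  apply norm_triangle.
Qed.

Lemma norm_minus_le_0 {K : AbsRing} {V : NormedModule K} (x y : V) :
  norm (minus x y) <= 0 -> x = y.
Proof.
  intros H.
  assert (H0 : minus x y = zero).
  { apply norm_eq_zero, Rle_antisym; [exact H | apply norm_ge_0]. }
  apply (plus_reg_r (opp y)). rewrite plus_opp_r. exact H0.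
Qed.

(* Completeness as a predicate on [NormedModule]: on a [CompleteNormedModule] the
   group operations also arise from a second, not syntactically equal inheritance
   path, on which [rewrite] fails. *)
Definition cauchy_complete {K : AbsRing} (V : NormedModule K) : Prop :=
  forall x : nat -> V,
  (forall eps : posreal, exists n0, forall m n, (n0 <= m)%nat -> (n0 <= n)%nat ->
     norm (minus (x n) (x m)) < eps) ->
  exists y : V, filterlim x eventually (locally y).

Lemma complete_cauchy_complete {K : AbsRing} (V : CompleteNormedModule K) :
  cauchy_complete V.
Proof.
  intros x Hx.
  apply (proj1 (filterlim_locally_cauchy (F := eventually) x)).
  intros eps. destruct (Hx eps) as [n0 Hn0].
  exists (fun n => (n0 <= n)%nat). split; [now exists n0|].
  intros m n Hm Hn. exact (norm_compat1 (V := V) _ _ _ (Hn0 m n Hm Hn)).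
Qed.

(** Halving gives [d k / 2 <= d k - d (S k)], so the increments telescope and everything after [x k]
    stays within [d k] of it. The explicit rate places the limit in all the closed balls around the
    [x k] at once. *)
Lemma halving_limit {K : AbsRing} {V : NormedModule K}
    (x : nat -> V) (d : nat -> R) :
  cauchy_complete V ->
  (forall k, d (S k) <= d k / 2) ->
  (forall k, norm (minus (x (S k)) (x k)) <= d k / 2) ->
  exists y : V, forall k, norm (minus y (x k)) <= d k.
Proof.
  intros HV Hd Hx.
  assert (Hpos : forall k, 0 <= d k).
  { intros k. pose proof (norm_ge_0 (minus (x (S k)) (x k))).
    specialize (Hx k). lra. }
  assert (Hshift : forall p k, norm (minus (x (p + k)%nat) (x k)) <= d k - d (p + k)%nat).
  { intros p k. induction p as [|p IH]; simpl.
    - rewrite norm_minus_diag. lra.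
    - pose proof (norm_minus_triangle (x (p + k)%nat) (x (S (p + k))) (x k)).
      specialize (Hd (p + k)%nat). specialize (Hx (p + k)%nat). lra. }
  assert (Hlate : forall k n, (k <= n)%nat -> norm (minus (x n) (x k)) <= d k).
  { intros k n Hkn. specialize (Hshift (n - k)%nat k). specialize (Hpos n).
    replace (n - k + k)%nat with n in Hshift by lia. lra. }
  destruct (HV x) as [y Hy].
  { intros eps.
    destruct (halving_lt d Hd (eps / 2)) as [k0 Hk0].
    { pose proof (cond_pos eps). lra. }
    exists k0. intros u v Hu Hv.
    pose proof (norm_minus_triangle (x k0) (x v) (x u)).
    pose proof (Hlate k0 v Hv). pose proof (Hlate k0 u Hu).
    rewrite (norm_minus_sym (x k0)) in H.
    specialize (Hk0 k0 (Nat.le_refl _)). lra. }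
  exists y. intros k. apply Rnot_lt_le. intros Hlt.
  (* A late term closer to [y] than the excess of the distance over [d k] would contradict
     [Hlate]. *)
  pose (e := mkposreal _ (proj1 (Rminus_lt_0 _ _) Hlt)).
  destruct (proj1 (filterlim_locally_ball_norm x y) Hy e) as [n0 Hn0].
  specialize (Hn0 (n0 + k)%nat ltac:(lia)). unfold ball_norm in Hn0. simpl in Hn0.
  rewrite norm_minus_sym in Hn0.
  pose proof (norm_minus_triangle (x (n0 + k)%nat) y (x k)).
  specialize (Hlate k (n0 + k)%nat ltac:(lia)). lra.
Qed.

(** * Bounded linear maps and surjectivity *)

Lemma is_linear_minus {K : AbsRing} {U V : NormedModule K} (A B : U -> V) :
  is_linear A -> is_linear B -> is_linear (fun x => minus (A x) (B x)).
Proof.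
  intros HA HB.
  apply (is_linear_comp (fun x => (A x, opp (B x))) (fun t => plus (fst t) (snd t))).
  - apply is_linear_prod; [exact HA|].
    apply (is_linear_comp B opp); [exact HB | apply is_linear_opp].
  - apply is_linear_plus.
Qed.

Lemma is_linear_iter {K : AbsRing} {X : NormedModule K} (T : X -> X) (n : nat) :
  is_linear T -> is_linear (Nat.iter n T).
Proof.
  intros HT. induction n as [|n IH]; simpl.
  - apply is_linear_id.
  - exact (is_linear_comp _ _ IH HT).
Qed.

Lemma norm_iter_le {K : AbsRing} {X : NormedModule K} (T : X -> X) (L : R) :
  0 <= L -> (forall x, norm (T x) <= L * norm x) ->
  forall n x, norm (Nat.iter n T x) <= L ^ n * norm x.
Proof.
  intros HL HT n x. induction n as [|n IH]; simpl; [lra|].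
  specialize (HT (Nat.iter n T x)). nra.
Qed.

(** Successive approximation, as in the open mapping theorem: solve for the residual, add the
    correction and repeat. The residuals halve and the corrections are bounded by [c] times them, so
    the partial sums converge to an exact solution. *)
Lemma surjective_of_approx {K : AbsRing} {X : NormedModule K}
    (A : X -> X) (c : R) :
  cauchy_complete X -> is_linear A -> 0 <= c ->
  (forall y, exists x, norm x <= c * norm y /\
                       norm (minus y (A x)) <= norm y / 2) ->
  forall y, exists x, A x = y.
Proof.
  intros HX HA Hc Happ y.
  destruct (functional_choice _ Happ) as [g Hg].
  (* [s n] is the sum of the first [n] corrections and [r n] the residual left after them. *)
  pose (s := fun n => Nat.iter n (fun x => plus x (g (minus y (A x)))) zero).
  pose (r := (fun n => minus y (A (s n))) : nat -> X).
  assert (Hr : forall n, norm (r (S n)) <= norm (r n) / 2).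
  { intros n. replace (r (S n)) with (minus (r n) (A (g (r n)))).
    - apply Hg.
    - unfold r at 3. simpl. fold (r n). rewrite (linear_plus A HA).
      exact (eq_sym (minus_plus_distr (G := X) _ _ _)). }
  destruct (halving_limit s (fun n => 2 * c * norm (r n)) HX) as [x Hx].
  - intros k. specialize (Hr k). nra.
  - intros k. replace (minus (s (S k)) (s k)) with (g (r k)).
    + destruct (Hg (r k)). lra.
    + exact (eq_sym (plus_minus_l (G := X) _ _)).
  - exists x. apply norm_minus_le_0.
    destruct (linear_norm A HA) as [M [HM HAM]].
    apply (halving_bound_le_0 (fun n => norm (r n)) _ (1 + M * (2 * c)) Hr); [nra|].
    intros n. pose proof (norm_minus_triangle (A (s n)) (A x) y) as H1.
    rewrite <- (linear_minus A x (s n) HA) in H1.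
    specialize (HAM (minus x (s n))). specialize (Hx n).
    rewrite (norm_minus_sym (A (s n)) y) in H1. fold (r n) in H1. simpl in Hx. nra.
Qed.

(** The module axiom gives one inequality; applying it to [/ l] and [scal l x] gives the other. *)
Lemma norm_scal_C {X : NormedModule C_AbsRing} (l : C) (x : X) :
  norm (scal l x) = Cmod l * norm x.
Proof.
  apply Rle_antisym; [apply (norm_scal l x)|].
  destruct (Ceq_dec l 0) as [->|Hl].
  - rewrite Cmod_0, Rmult_0_l. apply norm_ge_0.
  - pose proof (norm_scal (/ l)%C (scal l x)) as H.
    rewrite scal_assoc in H.
    change (mult (/ l)%C l) with (/ l * l)%C in H.
    rewrite Cinv_l in H by exact Hl.
    change (RtoC 1) with (@one C_AbsRing) in H.
    rewrite scal_one in H. change (abs (/ l)%C) with (Cmod (/ l)) in H.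
    rewrite Cmod_inv in H by exact Hl.
    assert (0 < Cmod l) by now apply Cmod_gt_0.
    apply Rmult_le_compat_l with (r := Cmod l) in H; [|lra].
    rewrite <- Rmult_assoc, Rinv_r, Rmult_1_l in H by lra. exact H.
Qed.

Lemma is_linear_shift {X : NormedModule C_AbsRing} (T : X -> X) (l : C) :
  is_linear T -> is_linear (fun x => minus (scal l x) (T x)).
Proof.
  intros HT. refine (is_linear_minus (fun x => scal l x) T _ HT).
  exact (is_linear_scal_r (V := X) l Cmult_comm).
Qed.

(** The lower bound serves twice: it makes [l - T] injective, so that a right inverse obtained by
    choice is linear and two-sided, and it bounds this inverse by [/ eps]. *)
Lemma not_spectrum {X : NormedModule C_AbsRing} (T : X -> X) (l : C) (eps : R) :
  is_linear T -> 0 < eps ->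
  (forall x, eps * norm x <= norm (minus (scal l x) (T x))) ->
  (forall y, exists x, minus (scal l x) (T x) = y) ->
  ~ spectrum T l.
Proof.
  intros HT Heps Hlow Hsurj Hsp. apply Hsp.
  pose proof (is_linear_shift T l HT) as HA.
  set (A := fun x => minus (scal l x) (T x)) in *.
  assert (Hinj : forall x x', A x = A x' -> x = x').
  { intros x x' H. apply norm_minus_le_0.
    apply (Rmult_le_reg_l _ _ _ Heps). rewrite Rmult_0_r.
    refine (Rle_trans _ _ _ (Hlow _) (Req_le _ _ _)).
    refine (eq_trans (f_equal norm (linear_minus A x x' HA)) _).
    rewrite H. apply norm_minus_diag. }
  destruct (functional_choice _ Hsurj) as [S HS].
  change (forall y, A (S y) = y) in HS.
  exists S. split; [split|split].
  - intros x y. apply Hinj. now rewrite (linear_plus A HA), !HS.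
  - intros k x. apply Hinj. now rewrite (linear_scal A HA), !HS.
  - exists (/ eps). split; [now apply Rinv_0_lt_compat|].
    intros y. specialize (Hlow (S y)). change (minus _ _) with (A (S y)) in Hlow.
    rewrite HS in Hlow. apply Rmult_le_reg_l with eps; [lra|].
    rewrite <- Rmult_assoc, Rinv_r, Rmult_1_l by lra. exact Hlow.
  - intros x. apply Hinj. now rewrite HS.
  - exact HS.
Qed.

(* Surjectivity of [l - T] is propagated radially inwards from large [|l|] in
   steps of length [eps / 2], a step being a small perturbation. *)
Lemma surjective_outside_disc {X : NormedModule C_AbsRing}
    (T : X -> X) (r eps : R) :
  cauchy_complete X -> is_linear T -> 0 < r -> 0 < eps ->
  (forall l x, r <= Cmod l -> eps * norm x <= norm (minus (scal l x) (T x))) ->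
  forall l y, r <= Cmod l -> exists x, minus (scal l x) (T x) = y.
Proof.
  intros HX HT Hr Heps Hlow.
  destruct (linear_norm T HT) as [L [HL HTL]].
  assert (Hind : forall (k : nat) l, r <= Cmod l ->
    2 * L - INR k * (eps / 2) <= Cmod l ->
    forall y, exists x, minus (scal l x) (T x) = y).
  { intros k. induction k as [|k IH]; intros l Hrl Hl.
    (* For [|l| >= 2 L] the vector [y / l] is an approximate solution: its residual [T (y / l)] has
       norm at most [norm y / 2]. *)
    - simpl in Hl.
      assert (Hl0 : l <> 0) by (apply Cmod_gt_0; lra).
      assert (Hinv : Cmod l * Cmod (/ l) = 1).
      { rewrite Cmod_inv by exact Hl0. field. lra. }
      apply (surjective_of_approx _ (Cmod (/ l)) HX (is_linear_shift T l HT)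
               (Cmod_ge_0 _)).
      intros y. exists (scal (/ l)%C y). rewrite norm_scal_C.
      split; [lra|].
      replace (minus y _) with (T (scal (/ l)%C y)).
      + specialize (HTL (scal (/ l)%C y)). rewrite norm_scal_C in HTL.
        pose proof (norm_ge_0 y). pose proof (Cmod_ge_0 (/ l)).
        assert (2 * L * Cmod (/ l) <= 1) by nra. nra.
      + rewrite scal_assoc. change (mult l (/ l)%C) with (l * / l)%C.
        rewrite Cinv_r by exact Hl0. change (RtoC 1) with (@one C_AbsRing).
        rewrite scal_one. exact (eq_sym (minus_minus_r (G := X) _ _)).
    (* [l'] lies [eps / 2] further out on the ray through [l]. An exact solution [x] for [l']
       satisfies [norm x <= norm y / eps], so its residual [(l' - l) x] for [l] is at most
       [norm y / 2]. *)
    - pose (l' := (RtoC (1 + eps / 2 / Cmod l) * l)%C).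
      assert (Hq : 0 < eps / 2 / Cmod l) by (apply Rdiv_lt_0_compat; lra).
      assert (Hl' : Cmod l' = Cmod l + eps / 2).
      { unfold l'. rewrite Cmod_mult, Cmod_R, Rabs_pos_eq by lra. field. lra. }
      assert (Hdiff : Cmod (l' - l) = eps / 2).
      { unfold l'. replace (_ - l)%C with (RtoC (eps / 2 / Cmod l) * l)%C.
        - rewrite Cmod_mult, Cmod_R, Rabs_pos_eq by lra. field. lra.
        - rewrite RtoC_plus. ring. }
      assert (Hsurj : forall y, exists x, minus (scal l' x) (T x) = y).
      { apply IH; [lra|]. rewrite S_INR in Hl. lra. }
      apply (surjective_of_approx _ (/ eps) HX (is_linear_shift T l HT)).
      { left. now apply Rinv_0_lt_compat. }
      intros y. destruct (Hsurj y) as [x Hx]. exists x.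
      assert (Hx' : norm x <= / eps * norm y).
      { specialize (Hlow l' x ltac:(lra)). rewrite Hx in Hlow.
        apply Rmult_le_reg_l with eps; [lra|].
        rewrite <- Rmult_assoc, Rinv_r, Rmult_1_l by lra. exact Hlow. }
      split; [exact Hx'|].
      replace (minus y _) with (scal (l' - l)%C x).
      + rewrite norm_scal_C, Hdiff.
        apply Rmult_le_compat_l with (r := eps / 2) in Hx'; [|lra].
        replace (eps / 2 * (/ eps * norm y)) with (norm y / 2) in Hx'
          by (field; lra). exact Hx'.
      + rewrite <- Hx. change (l' - l)%C with (@minus C_Ring l' l).
        rewrite (scal_minus_distr_r (V := X)). exact (eq_sym (minus_minus_cancel (G := X) _ _ _)). }
  intros l y Hl.
  destruct (INR_unbounded (2 * L / (eps / 2))) as [k Hk].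
  apply (Hind k l Hl).
  apply Rmult_gt_compat_r with (r := eps / 2) in Hk; [|lra].
  replace (2 * L / (eps / 2) * (eps / 2)) with (2 * L) in Hk by (field; lra). lra.
Qed.

(** * Approximate eigenvectors and their orbits *)

(** The threshold is [1 - eps] and not [1]: failure then confines the spectrum to the disc of radius
    [1 - eps], so that its supremum is strictly below [1]. *)
Lemma approximate_eigenvector {X : NormedModule C_AbsRing} (T : X -> X) :
  cauchy_complete X -> is_linear T -> ~ Rbar_lt (spectral_radius T) 1 ->
  forall eps, 0 < eps < 1 -> exists (l : C) (x : X),
    1 - eps <= Cmod l /\ norm x = 1 /\ norm (minus (scal l x) (T x)) < eps.
Proof.
  intros HX HT Hrad eps Heps. apply NNPP. intros Hno. apply Hrad.
  (* By homogeneity, a nonzero vector violating this bound could be normalised to an approximate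
     eigenvector. *)
  assert (Hlow : forall l x, 1 - eps <= Cmod l ->
    eps * norm x <= norm (minus (scal l x) (T x))).
  { intros l x Hl. apply Rnot_lt_le. intros Hlt. apply Hno.
    assert (Hx : 0 < norm x).
    { destruct (norm_ge_0 x) as [H|H]; [exact H|].
      rewrite <- H in Hlt. pose proof (norm_ge_0 (minus (scal l x) (T x))). lra. }
    pose proof (Rinv_0_lt_compat _ Hx) as Hinv.
    assert (Hmod : Cmod (/ norm x)%R = / norm x) by (rewrite Cmod_R; apply Rabs_pos_eq; lra).
    exists l, (scal (RtoC (/ norm x)) x). split; [exact Hl|split].
    - rewrite norm_scal_C, Hmod. now apply Rinv_l, Rgt_not_eq.
    - rewrite (f_equal norm (linear_scal _ (is_linear_shift T l HT) _ x)).
      rewrite norm_scal_C, Hmod.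
      apply Rmult_lt_reg_l with (norm x); [exact Hx|].
      rewrite <- Rmult_assoc, Rinv_r, Rmult_1_l by lra. lra. }
  unfold spectral_radius.
  apply Rbar_le_lt_trans with (1 - eps); [|simpl; lra].
  apply (proj2 (Lub_Rbar_correct _)).
  intros s [l [Hl ->]]. simpl. apply Rnot_lt_le. intros Hlt.
  apply (not_spectrum T l eps HT); [lra| | |exact Hl].
  - intros x. apply Hlow. lra.
  - intros y. apply (surjective_outside_disc T (1 - eps) eps); auto; lra.
Qed.

(** Passing from [n] to [n + 1] applies [T] to the old error and adds [l^n (l x - T x)]. The base
    [L + 1] dominates both [L] and [|l|] and is at least [1]. *)
Lemma norm_orbit_minus_le {X : NormedModule C_AbsRing} (T : X -> X) (L eps : R)
    (l : C) (x : X) :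
  is_linear T -> 0 <= L -> (forall z, norm (T z) <= L * norm z) ->
  eps <= 1 -> norm x = 1 -> norm (minus (scal l x) (T x)) < eps ->
  forall n, norm (minus (scal (l ^ n)%C x) (Nat.iter n T x))
            <= INR n * ((L + 1) ^ n * eps).
Proof.
  intros HT HL HTL Heps Hx Hl.
  assert (Heps0 : 0 < eps).
  { apply Rle_lt_trans with (2 := Hl), norm_ge_0. }
  assert (HlL : Cmod l <= L + 1).
  { pose proof (norm_le_minus (scal l x) (T x)) as H.
    rewrite norm_scal_C, Hx in H. specialize (HTL x). rewrite Hx in HTL.
    assert (H' : norm (minus (scal l x) (T x)) <= 1) by lra.
    pose proof (Rle_trans _ _ _ H (Rplus_le_compat_l _ _ _ H')). lra. }
  assert (Hpow : forall n, 1 <= (L + 1) ^ n) by (intros n; apply pow_R1_Rle; lra).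
  induction n as [|n IH].
  - simpl. change (RtoC 1) with (@one C_AbsRing).
    rewrite Rmult_0_l, (scal_one (V := X)).
    right. exact (norm_minus_diag (V := X) x).
  - set (y := Nat.iter n T x) in *. change (Nat.iter (S n) T x) with (T y).
    set (z := scal (l ^ n)%C x) in *.
    assert (H1 : norm (minus (scal (l ^ S n)%C x) (T z)) <= (L + 1) ^ n * eps).
    { replace (minus (scal (l ^ S n)%C x) (T z))
        with (scal (l ^ n)%C (minus (scal l x) (T x))).
      - rewrite norm_scal_C, Cmod_pow.
        apply Rmult_le_compat; [apply pow_le, Cmod_ge_0 | apply norm_ge_0 | | lra].
        apply pow_incr. split; [apply Cmod_ge_0 | exact HlL].
      - unfold z. rewrite (linear_scal T HT).
        refine (eq_trans (scal_minus_distr_l (V := X) _ _ _) _).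
        apply (f_equal (fun w => minus w (scal (l ^ n)%C (T x)))).
        refine (eq_trans (scal_assoc (V := X) _ _ _) _).
        apply (f_equal (fun w => scal w x)).
        change (l ^ n * l = l ^ S n)%C. simpl. apply Cmult_comm. }
    assert (H2 : norm (minus (T z) (T y)) <= L * norm (minus z y)).
    { rewrite <- (f_equal norm (linear_minus T z y HT)). apply HTL. }
    pose proof (norm_minus_triangle (T z) (scal (l ^ S n)%C x) (T y)) as H3.
    refine (Rle_trans _ _ _ H3 (Rle_trans _ _ _ (Rplus_le_compat _ _ _ _ H1 H2) _)).
    refine (Rle_trans _ _ _ (Rplus_le_compat_l _ _ _
              (Rmult_le_compat_l _ _ _ HL IH)) _).
    rewrite S_INR. simpl. specialize (Hpow n). pose proof (pos_INR n).
    assert (0 <= (L + 1) ^ n * eps) by nra.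
    assert (0 <= INR n * ((L + 1) ^ n * eps)) by nra.
    nra.
Qed.

(** * The dual norm and orbits that stay away from zero *)

Lemma dual_norm_le {X : NormedModule C_AbsRing} (phi : X -> C) (r : R) :
  0 <= r -> (forall z, Cmod (phi z) <= r * norm z) -> Rbar_le (dual_norm phi) r.
Proof.
  intros Hr H. apply (proj2 (Lub_Rbar_correct _)).
  intros s [x [Hx ->]]. simpl. specialize (H x). nra.
Qed.

Lemma Cmod_le_of_dual_norm {X : NormedModule C_AbsRing} (phi : X -> C) (r : R) :
  is_linear phi -> Rbar_le (dual_norm phi) r ->
  forall z, Cmod (phi z) <= r * norm z.
Proof.
  intros Hphi H z.
  destruct (norm_ge_0 z) as [Hz|Hz].
  - assert (Hmod : Cmod (/ norm z)%R = / norm z).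
    { rewrite Cmod_R. apply Rabs_pos_eq. left. now apply Rinv_0_lt_compat. }
    assert (Hs : Cmod (phi (scal (RtoC (/ norm z)) z)) <= r).
    { change (Rbar_le (Cmod (phi (scal (RtoC (/ norm z)) z))) r).
      refine (Rbar_le_trans _ _ _ (proj1 (Lub_Rbar_correct _) _ _) H).
      exists (scal (RtoC (/ norm z)) z). split; [|reflexivity].
      rewrite norm_scal_C, Hmod, Rinv_l by lra. lra. }
    rewrite (linear_scal phi Hphi) in Hs.
    change (Cmod (RtoC (/ norm z) * phi z)%C <= r) in Hs.
    rewrite Cmod_mult, Hmod in Hs.
    apply Rmult_le_compat_r with (r := norm z) in Hs; [|lra].
    replace (/ norm z * Cmod (phi z) * norm z) with (Cmod (phi z)) in Hs
      by (field; lra).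
    exact Hs.
  - assert (z = zero) as -> by (apply norm_eq_zero; lra).
    rewrite (linear_zero phi Hphi). change (@zero C_NormedModule) with (RtoC 0).
    rewrite Cmod_0. rewrite <- Hz. lra.
Qed.

(** A form of Bernoulli's inequality. *)
Lemma one_sub_mul_le_pow (a eps : R) (n : nat) :
  0 <= eps <= 1 -> 1 - eps <= a -> 1 - INR n * eps <= a ^ n.
Proof.
  intros He Ha. induction n as [|n IH]; [simpl; lra|].
  rewrite S_INR. simpl. pose proof (pos_INR n).
  assert (0 <= a ^ n) by (apply pow_le; lra).
  nra.
Qed.

(** Along an approximate eigenvector [psi (T^j u)] is close to [l^j psi u], where [|l|^j] is nearly
    [1] or larger. The bound [eta] depends only on the norming constant, while [eps] is adapted to
    [N]. *)
Lemma long_orbits {X : NormedModule C_AbsRing} (E : (X -> C) -> Prop) (T : X -> X) :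
  cauchy_complete X -> dual_subspace E -> almost_norming E -> is_linear T ->
  ~ Rbar_lt (spectral_radius T) 1 ->
  exists eta, 0 < eta /\ forall N, exists (u : X) (psi : X -> C),
    norm u <= 1 /\ E psi /\ (forall z, Cmod (psi z) <= norm z) /\
    forall j, (j <= N)%nat -> eta <= Cmod (psi (Nat.iter j T u)).
Proof.
  intros HX HE [K [HK Hnorming]] HT Hrad.
  exists (/ (4 * K)). split; [apply Rinv_0_lt_compat; lra|]. intros N.
  destruct (linear_norm T HT) as [L [HL HTL]].
  set (P := INR N * (L + 1) ^ N).
  assert (HpowL : forall n, 1 <= (L + 1) ^ n) by (intros n; apply pow_R1_Rle; lra).
  assert (HP : 0 <= P).
  { pose proof (pos_INR N). specialize (HpowL N). unfold P. nra. }
  assert (HKP : 0 <= K * P) by nra.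
  pose proof (pos_INR N) as HN.
  (* The three summands of [D] give [eps <= 1 / 2], [N eps <= 1 / 4] and [K P eps <= 1 / 8]. With
     [K |phi u| > 1 / 2] and [|l|^j >= 3 / 4], at least [3 / 8 - 1 / 8 = 1 / 4] remains of
     [K |phi (T^j u)|]. *)
  set (D := 2 + 4 * INR N + 8 * (K * P)). set (eps := / D).
  assert (HD : 2 <= D) by (unfold D; lra).
  assert (HepsD : D * eps = 1) by (unfold eps; apply Rinv_r; lra).
  assert (Heps : 0 < eps) by (apply Rinv_0_lt_compat; lra).
  assert (HepsN : INR N * eps <= / 4) by (unfold D in HepsD; nra).
  assert (HepsP : K * (P * eps) <= / 8) by (unfold D in HepsD; nra).
  destruct (approximate_eigenvector T HX HT Hrad eps) as [l [u [Hl [Hu Heig]]]].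
  { split; [lra|]. nra. }
  assert (Hphi : exists phi, E phi /\ Rbar_le (dual_norm phi) 1 /\ 1 / 2 < K * Cmod (phi u)).
  { apply NNPP. intros Hno.
    assert (Hle : Rbar_le (norm u) (1 / 2)).
    { refine (Rbar_le_trans _ _ _ (Hnorming u) (proj2 (Lub_Rbar_correct _) _ _)).
      intros s [phi [HEphi [Hphi ->]]]. simpl. apply Rnot_lt_le. intros Hlt.
      apply Hno. now exists phi. }
    simpl in Hle. lra. }
  destruct Hphi as [phi [HEphi [Hphi Hphiu]]].
  pose proof (dual_subspace_incl E HE phi HEphi) as Hlin.
  pose proof (Cmod_le_of_dual_norm phi 1 Hlin Hphi) as Hbound.
  exists u, phi. split; [lra|split; [exact HEphi|split]].
  { intros z. rewrite <- (Rmult_1_l (norm z)). apply Hbound. }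
  intros j Hj.
  assert (Hdist : Cmod (l ^ j * phi u - phi (Nat.iter j T u)) <= P * eps).
  { replace (l ^ j * phi u - phi (Nat.iter j T u))%C
      with (phi (minus (scal (l ^ j)%C u) (Nat.iter j T u))).
    - refine (Rle_trans _ _ _ (Hbound _) _). rewrite Rmult_1_l.
      refine (Rle_trans _ _ _ (norm_orbit_minus_le T L eps l u HT (Rlt_le _ _ HL) HTL _ Hu Heig j) _).
      { nra. }
      unfold P. rewrite <- Rmult_assoc. apply Rmult_le_compat_r; [lra|].
      apply Rmult_le_compat; [apply pos_INR | specialize (HpowL j); lra | now apply le_INR |].
      apply Rle_pow; [lra | exact Hj].
    - refine (eq_trans (linear_minus phi _ _ Hlin) _).
      rewrite (linear_scal phi Hlin). reflexivity. }
  assert (Htri : Cmod (l ^ j * phi u)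
                 <= Cmod (l ^ j * phi u - phi (Nat.iter j T u))
                    + Cmod (phi (Nat.iter j T u))).
  { replace (l ^ j * phi u)%C with ((l ^ j * phi u - phi (Nat.iter j T u))
       + phi (Nat.iter j T u))%C at 1 by ring. apply Cmod_triangle. }
  rewrite Cmod_mult, Cmod_pow in Htri.
  assert (Hpow : 3 / 4 <= Cmod l ^ j).
  { pose proof (one_sub_mul_le_pow (Cmod l) eps j).
    assert (INR j * eps <= INR N * eps) by (apply Rmult_le_compat_r; [lra | now apply le_INR]).
    assert (eps <= 1) by nra. lra. }
  assert (Hmain : 1 / 4 <= K * Cmod (phi (Nat.iter j T u))).
  { pose proof (Cmod_ge_0 (phi u)).
    assert (3 / 4 * Cmod (phi u) <= Cmod l ^ j * Cmod (phi u)) by nra. nra. }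
  apply Rmult_le_reg_l with K; [exact HK|].
  replace (K * / (4 * K)) with (1 / 4) by (field; lra). exact Hmain.
Qed.

(** * Rearrangements and counting *)

Lemma card_le_sub (A B : nat -> Prop) (n : nat) :
  (forall k, A k -> B k) -> card_le B n -> card_le A n.
Proof. intros H [l [Hl HB]]. exists l. auto. Qed.

(** An admissible level below [t] would make [t] violate [Hcard]. The bound on [h] supplies an
    admissible level, so the infimum is finite and [real] does not fall back to its default [0]. *)
Lemma rearrangement_ge (h : nat -> R) (n : nat) (t : R) :
  (exists B, forall k, h k <= B) ->
  ~ card_le (fun k => t < h k) n -> t <= rearrangement h n.
Proof.
  intros [B HB] Hcard. unfold rearrangement.
  set (A := fun s => _).
  destruct (Glb_Rbar_correct A) as [Hlb Hglb].
  assert (Ht : Rbar_le t (Glb_Rbar A)).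
  { apply Hglb. intros s [_ Hs]. simpl. apply Rnot_lt_le. intros Hlt.
    apply Hcard. apply card_le_sub with (2 := Hs). intros k Hk. lra. }
  assert (Hfin : Rbar_le (Glb_Rbar A) (Rmax B 0)).
  { apply Hlb. split; [apply Rmax_r|]. exists nil. split; [simpl; lia|].
    intros k Hk. specialize (HB k). pose proof (Rmax_l B 0). lra. }
  destruct (Glb_Rbar A); simpl in *; [exact Ht | easy | easy].
Qed.

Lemma c0_bounded (a : nat -> C) : c0 a -> exists B, forall k, Cmod (a k) <= B.
Proof.
  intros Ha.
  destruct (filterlim_bounded (V := R_NormedModule) (fun n => Cmod (a n))) as [B HB].
  { now exists 0. }
  exists B. intros k. apply Rle_trans with (2 := HB k). apply Rle_abs.
Qed.

Lemma c0_nonneg_lt (f : nat -> R) (eps : R) :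
  c0_nonneg f -> 0 < eps -> exists n, f n < eps.
Proof.
  intros [Hf _] Heps. apply is_lim_seq_spec in Hf.
  destruct (Hf (mkposreal eps Heps)) as [n Hn]. exists n.
  specialize (Hn n (Nat.le_refl n)). simpl in Hn.
  rewrite Rminus_0_r, Rabs_pos_eq in Hn by apply Cmod_ge_0.
  rewrite Cmod_R in Hn. pose proof (Rle_abs (f n)). lra.
Qed.

(** There are [4 m + 1] indices, one more than four lists of length [m] can cover. *)
Lemma pigeonhole_four (P : bool -> bool -> nat -> Prop) (m : nat) :
  (forall j, (j <= 4 * m)%nat -> exists a b, P a b j) ->
  exists a b, ~ card_le (P a b) m.
Proof.
  intros HP. apply NNPP. intros Hno.
  assert (Hall : forall a b, card_le (P a b) m).
  { intros a b. apply NNPP. intros H. apply Hno. now exists a, b. }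
  destruct (Hall true true) as [l1 [Hl1 H1]].
  destruct (Hall true false) as [l2 [Hl2 H2]].
  destruct (Hall false true) as [l3 [Hl3 H3]].
  destruct (Hall false false) as [l4 [Hl4 H4]].
  assert (Hlen : (length (seq 0 (S (4 * m))) <= length (l1 ++ l2 ++ l3 ++ l4))%nat).
  { apply NoDup_incl_length; [apply seq_NoDup|].
    intros j Hj. apply in_seq in Hj. rewrite !in_app_iff.
    destruct (HP j ltac:(lia)) as [[|] [[|] Hab]]; auto. }
  rewrite length_seq, !length_app in Hlen. lia.
Qed.

(** * The gliding hump *)

Definition sgn (b : bool) : C := if b then 1%C else (- (1))%C.

Lemma Cmod_sgn (b : bool) : Cmod (sgn b) = 1.
Proof. destruct b; [exact Cmod_1 | exact Cmod_m1]. Qed.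

(* [4 w] is the combination of the four left-hand sides with coefficients
   [sgn s * sgn s']. *)
Lemma polarization (a b c w : C) (e : R) :
  e <= Cmod w ->
  exists s s', e <= Cmod (a + sgn s * b + sgn s' * (c + sgn s * w)).
Proof.
  intros Hw. apply NNPP. intros Hno.
  assert (Hall : forall s s', Cmod (a + sgn s * b + sgn s' * (c + sgn s * w)) < e).
  { intros s s'. apply Rnot_le_lt. intros H. apply Hno. now exists s, s'. }
  pose (v := fun s s' => (a + sgn s * b + sgn s' * (c + sgn s * w))%C).
  assert (Heq : (RtoC 4 * w = (v true true + (- v true false))
                        + ((- v false true) + v false false))%C).
  { unfold v, sgn. replace (RtoC 4) with (1 + 1 + 1 + 1)%C by (rewrite <- !RtoC_plus; f_equal; lra).
    ring. }
  apply (f_equal Cmod) in Heq.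
  rewrite Cmod_mult, Cmod_R, Rabs_pos_eq in Heq by lra.
  pose proof (Cmod_triangle (v true true + - v true false) (- v false true + v false false)).
  pose proof (Cmod_triangle (v true true) (- v true false)).
  pose proof (Cmod_triangle (- v false true) (v false false)).
  rewrite Cmod_opp in *.
  pose proof (Hall true true). pose proof (Hall true false).
  pose proof (Hall false true). pose proof (Hall false false).
  fold (v true true) (v true false) (v false true) (v false false) in *. lra.
Qed.

(** For a bounded orbit sequence this puts entry [n] of its rearrangement at or above [t], hence
    above [k f_n]. Counting the values above [t] avoids infima and behaves well under
    perturbation. *)
Definition ungoverned {X : NormedModule C_AbsRing} (T : X -> X) (f : nat -> R)
    (k : nat) (x : X) (phi : X -> C) : Prop :=
  exists n t, INR k * f n < t /\
    ~ card_le (fun j => t < Cmod (phi (Nat.iter j T x))) n.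

(** Only the finitely many indices [j <= N] have to be controlled, and the gap between [2 * t] and
    [t] absorbs the perturbation. *)
Lemma ungoverned_nearby {X : NormedModule C_AbsRing} (T : X -> X) (f : nat -> R)
    (k N n : nat) (t : R) (x : X) (phi : X -> C) :
  is_linear T -> is_linear phi -> 0 < t -> INR k * f n < t ->
  ~ card_le (fun j => (j <= N)%nat /\ 2 * t <= Cmod (phi (Nat.iter j T x))) n ->
  exists d, 0 < d /\ forall p psi,
    norm (minus p x) <= d -> (forall z, Cmod (psi z - phi z) <= d * norm z) ->
    ungoverned T f k p psi.
Proof.
  intros HT Hphi Ht Hk Hcard.
  destruct (linear_norm T HT) as [L [HL HTL]].
  destruct (linear_norm phi Hphi) as [B [HB HphiB]].
  change (forall z, Cmod (phi z) <= B * norm z) in HphiB.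
  assert (HTM : forall z, norm (T z) <= (L + 1) * norm z).
  { intros z. specialize (HTL z). pose proof (norm_ge_0 z). lra. }
  assert (HM : 1 <= (L + 1) ^ N) by (apply pow_R1_Rle; lra).
  pose proof (norm_ge_0 x) as Hx.
  (* [d * Q] bounds the total change of an orbit value: the [B] term comes from moving [x], the
     [norm x + 1] term from moving [phi], with [norm p <= norm x + 1] because [d <= 1]. *)
  set (Q := (L + 1) ^ N * (norm x + 1 + B)).
  assert (HQ : 0 < Q) by (unfold Q; apply Rmult_lt_0_compat; lra).
  assert (HtQ : 0 < t / (2 * Q)) by (apply Rdiv_lt_0_compat; lra).
  exists (Rmin 1 (t / (2 * Q))). set (d := Rmin 1 (t / (2 * Q))).
  assert (Hd : 0 < d) by (apply Rmin_glb_lt; lra).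
  assert (Hd1 : d <= 1) by apply Rmin_l.
  assert (HdQ : d * Q < t).
  { apply Rle_lt_trans with (t / (2 * Q) * Q).
    - apply Rmult_le_compat_r; [lra | apply Rmin_r].
    - replace (t / (2 * Q) * Q) with (t / 2) by (field; lra). lra. }
  split; [exact Hd|]. intros p psi Hp Hpsi.
  exists n, t. split; [exact Hk|]. intros Hc. apply Hcard.
  apply card_le_sub with (2 := Hc). intros j [Hj Hjt].
  assert (HMj : forall z, norm (Nat.iter j T z) <= (L + 1) ^ N * norm z).
  { intros z.
    refine (Rle_trans _ _ _ (norm_iter_le T (L + 1) _ HTM j z) _); [lra|].
    apply Rmult_le_compat_r; [apply norm_ge_0|]. apply Rle_pow; [lra | exact Hj]. }
  pose proof (is_linear_iter T j HT) as HTj.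
  set (y := Nat.iter j T x) in *. set (q := Nat.iter j T p) in *.
  assert (H1 : Cmod (phi y - phi q) <= B * ((L + 1) ^ N * d)).
  { replace (phi y - phi q)%C with (phi (minus y q)) by exact (linear_minus phi y q Hphi).
    refine (Rle_trans _ _ _ (HphiB _) _). apply Rmult_le_compat_l; [lra|].
    unfold y, q. rewrite norm_minus_sym.
    rewrite <- (f_equal norm (linear_minus _ p x HTj)).
    refine (Rle_trans _ _ _ (HMj _) _). apply Rmult_le_compat_l; lra. }
  assert (H2 : Cmod (psi q - phi q) <= d * ((L + 1) ^ N * (norm x + 1))).
  { refine (Rle_trans _ _ _ (Hpsi q) _). apply Rmult_le_compat_l; [lra|].
    refine (Rle_trans _ _ _ (HMj p) _). apply Rmult_le_compat_l; [lra|].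
    refine (Rle_trans _ _ _ (norm_le_minus p x) _).
    apply Rplus_le_compat_l. exact (Rle_trans _ _ _ Hp Hd1). }
  assert (H3 : Cmod (phi y) <= Cmod (psi q) + Cmod (phi y - phi q) + Cmod (psi q - phi q)).
  { replace (phi y) with ((psi q + (phi y - phi q)) + - (psi q - phi q))%C at 1 by ring.
    rewrite <- (Cmod_opp (psi q - phi q)).
    refine (Rle_trans _ _ _ (Cmod_triangle _ _) _).
    apply Rplus_le_compat_r, Cmod_triangle. }
  replace (d * Q) with (B * ((L + 1) ^ N * d) + d * ((L + 1) ^ N * (norm x + 1)))
    in HdQ by (unfold Q; ring).
  lra.
Qed.

(** The order of choices is what matters: the amplitude [d / 2] fixes [t], then [m] is taken with
    [k f_m < t], and only then are [u] and [psi] chosen for the orbit length [4 m]. *)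
Lemma hump_step {X : NormedModule C_AbsRing} (E : (X -> C) -> Prop) (T : X -> X)
    (f : nat -> R) (eta : R) :
  dual_subspace E -> is_linear T -> c0_nonneg f -> 0 < eta ->
  (forall N, exists (u : X) (psi : X -> C),
    norm u <= 1 /\ E psi /\ (forall z, Cmod (psi z) <= norm z) /\
    forall j, (j <= N)%nat -> eta <= Cmod (psi (Nat.iter j T u))) ->
  forall (k : nat) (x : X) (phi : X -> C) (d : R), E phi -> 0 < d ->
  exists x' phi' d', E phi' /\ 0 < d' /\ d' <= d / 2 /\
    norm (minus x' x) <= d / 2 /\
    (forall z, Cmod (phi' z - phi z) <= d / 2 * norm z) /\
    forall p psi, norm (minus p x') <= d' ->
      (forall z, Cmod (psi z - phi' z) <= d' * norm z) -> ungoverned T f k p psi.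
Proof.
  intros HE HT Hf Heta Hlong k x phi d HEphi Hd.
  set (al := d / 2). assert (Hal : 0 < al) by (unfold al; lra).
  (* Polarization yields values of modulus at least [al^2 eta = 2 t]; half of this is kept as slack
     for later perturbations. *)
  set (t := al * al * eta / 2).
  assert (Ht : 0 < t) by (unfold t; repeat apply Rmult_lt_0_compat; lra).
  destruct (c0_nonneg_lt f (t / (INR k + 1)) Hf) as [m Hm].
  { apply Rdiv_lt_0_compat; [exact Ht|]. pose proof (pos_INR k). lra. }
  assert (Hkm : INR k * f m < t).
  { pose proof (pos_INR k) as Hk. destruct Hf as [_ Hf0]. specialize (Hf0 m).
    apply Rmult_lt_compat_r with (r := INR k + 1) in Hm; [|lra].
    replace (t / (INR k + 1) * (INR k + 1)) with t in Hm by (field; lra). nra. }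
  destruct (Hlong (4 * m)%nat) as [u [psi [Hu [HEpsi [Hpsi Horb]]]]].
  pose proof (dual_subspace_incl E HE _ HEphi) as Hphilin.
  pose proof (dual_subspace_incl E HE _ HEpsi) as Hpsilin.
  set (x' := fun s => plus x (scal (sgn s * al)%C u) : X).
  set (phi' := fun s' z => (phi z + (sgn s' * al) * psi z)%C).
  assert (HEphi' : forall s', E (phi' s')).
  { intros s'. apply (dual_subspace_plus E HE); [exact HEphi|].
    now apply (dual_subspace_scal E HE). }
  assert (Hsgn : forall s, Cmod (sgn s * al) = al).
  { intros s. rewrite Cmod_mult, Cmod_sgn, Cmod_R, Rabs_pos_eq; lra. }
  (* The good signs given by polarization vary with [j]; the pigeonhole fixes one pair of signs that
     is good for more than [m] indices. *)
  destruct (pigeonhole_four (fun s s' j => (j <= 4 * m)%nat /\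
      2 * t <= Cmod (phi' s' (Nat.iter j T (x' s)))) m) as [s [s' Hss]].
  { intros j Hj.
    destruct (polarization (phi (Nat.iter j T x)) (al * phi (Nat.iter j T u))
                (al * psi (Nat.iter j T x)) (al * al * psi (Nat.iter j T u)) (2 * t))
      as [s [s' Hpol]].
    { rewrite !Cmod_mult, Cmod_R, Rabs_pos_eq by lra. unfold t.
      specialize (Horb j Hj). assert (0 < al * al) by nra. nra. }
    exists s, s'. split; [exact Hj|].
    pose proof (is_linear_iter T j HT) as HTj.
    assert (Hval : forall g : X -> C, is_linear g -> g (Nat.iter j T (x' s))
              = (g (Nat.iter j T x) + sgn s * al * g (Nat.iter j T u))%C).
    { intros g Hg. unfold x'.
      rewrite (linear_plus _ HTj), (linear_scal _ HTj), (linear_plus g Hg).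
      now rewrite (linear_scal g Hg). }
    unfold phi'. rewrite (Hval phi Hphilin), (Hval psi Hpsilin).
    match type of Hpol with _ <= Cmod ?a => match goal with |- _ <= Cmod ?b =>
      replace b with a by ring end end.
    exact Hpol. }
  destruct (ungoverned_nearby T f k (4 * m) m t (x' s) (phi' s') HT
              (dual_subspace_incl E HE _ (HEphi' s')) Ht Hkm Hss) as [d0 [Hd0 Hnear]].
  (* The radius keeps later perturbations inside the stable neighbourhood and also preserves the
     halving. *)
  exists (x' s), (phi' s'), (Rmin d0 (d / 2)).
  split; [apply HEphi'|]. split; [apply Rmin_glb_lt; lra|].
  split; [apply Rmin_r|]. split; [|split].
  - unfold x'.
    refine (Rle_trans _ _ _ (Req_le _ _ (f_equal norm (plus_minus_l (G := X) _ _))) _).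
    rewrite norm_scal_C, Hsgn. fold al. nra.
  - intros z. unfold phi'.
    replace (phi z + sgn s' * al * psi z - phi z)%C with (sgn s' * al * psi z)%C by ring.
    rewrite Cmod_mult, Hsgn. apply Rmult_le_compat_l; [lra | apply Hpsi].
  - intros p g Hp Hg. apply Hnear.
    + apply Rle_trans with (1 := Hp), Rmin_l.
    + intros z. apply Rle_trans with (1 := Hg z).
      apply Rmult_le_compat_r; [apply norm_ge_0 | apply Rmin_l].
Qed.

(** The state for dependent choice. Membership in [E] and positivity are fields so that every state
    has a successor; the index records which constant the next step has to defeat. *)
Record hump {X : NormedModule C_AbsRing} (E : (X -> C) -> Prop) : Type := {
  hump_index : nat;
  hump_vec : X;
  hump_fun : X -> C;
  hump_rad : R;
  hump_fun_in : E hump_fun;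
  hump_rad_pos : 0 < hump_rad }.
Arguments hump_index {X E}.
Arguments hump_vec {X E}.
Arguments hump_fun {X E}.
Arguments hump_rad {X E}.
Arguments hump_fun_in {X E}.
Arguments hump_rad_pos {X E}.

(** Completeness of the complex numbers gives pointwise limits. The error is uniform relative to
    [norm z], so the limit is linear and bounded and is approached in the dual norm; closedness then
    puts it in [E]. *)
Lemma dual_limit {X : NormedModule C_AbsRing} (E : (X -> C) -> Prop)
    (phi : nat -> X -> C) (d : nat -> R) :
  dual_subspace E -> dual_closed E -> (forall k, E (phi k)) ->
  (forall k, 0 <= d k) -> (forall k, d (S k) <= d k / 2) ->
  (forall k z, Cmod (phi (S k) z - phi k z) <= d k / 2 * norm z) ->
  exists g, E g /\ forall k z, Cmod (g z - phi k z) <= d k * norm z.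
Proof.
  intros HE Hclosed HEphi Hd0 Hd Hphi.
  destruct (functional_choice
    (fun z (c : C) => forall k, Cmod (c - phi k z) <= d k * norm z)) as [g Hg].
  { intros z.
    apply (halving_limit (V := C_NormedModule) (fun k => phi k z)
             (fun k => d k * norm z)).
    - exact (complete_cauchy_complete C_CompleteNormedModule).
    - intros k. specialize (Hd k). pose proof (norm_ge_0 z). nra.
    - intros k. specialize (Hphi k z).
      replace (d k * norm z / 2) with (d k / 2 * norm z) by field. exact Hphi. }
  exists g. split; [|intros k z; apply Hg].
  pose proof (fun k => dual_subspace_incl E HE _ (HEphi k)) as Hlin.
  (* Both linearity identities follow by comparison with [phi k]; [M] collects the norms that
     multiply [d k] in the errors. *)
  assert (Hzero : forall (a b : C) M, 0 <= M ->
    (forall k, Cmod (a - b) <= M * d k) -> a = b).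
  { intros a b M HM H. apply (norm_minus_le_0 (V := C_NormedModule)).
    exact (halving_bound_le_0 d _ M Hd HM H). }
  apply Hclosed.
  - split.
    + intros x y. change (g (plus x y) = (g x + g y)%C).
      apply (Hzero _ _ (norm (plus x y) + norm x + norm y)).
      { pose proof (norm_ge_0 (plus x y)). pose proof (norm_ge_0 x).
        pose proof (norm_ge_0 y). lra. }
      intros k. pose proof (linear_plus _ (Hlin k) x y) as H.
      change (phi k (plus x y) = phi k x + phi k y)%C in H.
      replace (g (plus x y) - (g x + g y))%C
        with ((g (plus x y) - phi k (plus x y))
               + (- (g x - phi k x) + - (g y - phi k y)))%C by (rewrite H; ring).
      pose proof (Cmod_triangle (g (plus x y) - phi k (plus x y))
                    (- (g x - phi k x) + - (g y - phi k y))).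
      pose proof (Cmod_triangle (- (g x - phi k x)) (- (g y - phi k y))).
      rewrite !Cmod_opp in H1.
      pose proof (Hg (plus x y) k). pose proof (Hg x k). pose proof (Hg y k). lra.
    + intros c x. change (g (scal c x) = (c * g x)%C).
      apply (Hzero _ _ (norm (scal c x) + Cmod c * norm x)).
      { pose proof (norm_ge_0 (scal c x)). pose proof (norm_ge_0 x).
        pose proof (Cmod_ge_0 c). nra. }
      intros k. pose proof (linear_scal _ (Hlin k) c x) as H.
      change (phi k (scal c x) = c * phi k x)%C in H.
      replace (g (scal c x) - c * g x)%C
        with ((g (scal c x) - phi k (scal c x)) + - (c * (g x - phi k x)))%C
        by (rewrite H; ring).
      pose proof (Cmod_triangle (g (scal c x) - phi k (scal c x))
                    (- (c * (g x - phi k x)))) as H1.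
      rewrite Cmod_opp, Cmod_mult in H1.
      pose proof (Hg (scal c x) k).
      pose proof (Rmult_le_compat_l _ _ _ (Cmod_ge_0 c) (Hg x k)). lra.
    + destruct (linear_norm _ (Hlin 0%nat)) as [B [HB HphiB]].
      exists (B + d 0%nat). specialize (Hd0 0%nat). split; [lra|].
      intros x. change (Cmod (g x) <= (B + d 0%nat) * norm x).
      specialize (HphiB x). change (Cmod (phi 0%nat x) <= B * norm x) in HphiB.
      replace (g x) with ((g x - phi 0%nat x) + phi 0%nat x)%C by ring.
      pose proof (Cmod_triangle (g x - phi 0%nat x) (phi 0%nat x)).
      specialize (Hg x 0%nat). lra.
  - intros eps. destruct (halving_lt d Hd eps (cond_pos eps)) as [k Hk].
    specialize (Hk k (Nat.le_refl k)).
    exists (phi k). split; [apply HEphi|].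
    apply Rbar_le_lt_trans with (d k); [|exact Hk].
    apply dual_norm_le; [apply Hd0|]. intros z. apply Hg.
Qed.

Lemma ungoverned_exists {X : NormedModule C_AbsRing} (E : (X -> C) -> Prop)
    (T : X -> X) (f : nat -> R) :
  cauchy_complete X -> dual_subspace E -> dual_closed E -> almost_norming E ->
  is_linear T -> c0_nonneg f -> ~ Rbar_lt (spectral_radius T) 1 ->
  exists (x : X) (phi : X -> C), E phi /\ forall k, ungoverned T f k x phi.
Proof.
  intros HX HE Hclosed Hnorming HT Hf Hrad.
  destruct (long_orbits E T HX HE Hnorming HT Hrad) as [eta [Heta Hlong]].
  pose proof (hump_step E T f eta HE HT Hf Heta Hlong) as Hstep.
  destruct (dependent_choice (hump E) (fun h h' =>
      hump_index h' = S (hump_index h) /\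
      hump_rad h' <= hump_rad h / 2 /\
      norm (minus (hump_vec h') (hump_vec h)) <= hump_rad h / 2 /\
      (forall z, Cmod (hump_fun h' z - hump_fun h z) <= hump_rad h / 2 * norm z) /\
      forall p psi, norm (minus p (hump_vec h')) <= hump_rad h' ->
        (forall z, Cmod (psi z - hump_fun h' z) <= hump_rad h' * norm z) ->
        ungoverned T f (hump_index h) p psi)) with
    (x0 := {| hump_index := 0; hump_vec := zero : X; hump_fun := fun _ => RtoC 0;
              hump_rad := 1; hump_fun_in := dual_subspace_zero E HE;
              hump_rad_pos := Rlt_0_1 |}) as [s [Hs0 Hs]].
  { intros [k x phi d HEphi Hd].
    destruct (Hstep k x phi d HEphi Hd) as [x' [phi' [d' [HEphi' [Hd' H]]]]].
    exists {| hump_index := S k; hump_vec := x'; hump_fun := phi'; hump_rad := d';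
              hump_fun_in := HEphi'; hump_rad_pos := Hd' |}.
    simpl. split; [reflexivity | exact H]. }
  assert (Hindex : forall k, hump_index (s k) = k).
  { intros k. induction k as [|k IH]; [now rewrite Hs0|].
    destruct (Hs k) as [H _]. now rewrite H, IH. }
  destruct (halving_limit (fun k => hump_vec (s k)) (fun k => hump_rad (s k)) HX)
    as [x Hx].
  { intros k. apply Hs. }
  { intros k. apply Hs. }
  destruct (dual_limit E (fun k => hump_fun (s k)) (fun k => hump_rad (s k)) HE Hclosed)
    as [phi [HEphi Hphi]].
  { intros k. apply hump_fun_in. }
  { intros k. apply Rlt_le, hump_rad_pos. }
  { intros k. apply Hs. }
  { intros k. apply Hs. }
  exists x, phi. split; [exact HEphi|]. intros k.
  (* The step from [s k] to [s (S k)] defeats the constant [k] on the whole ball around [s (S k)],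
     which contains the limit pair. *)
  destruct (Hs k) as [_ [_ [_ [_ H]]]]. rewrite Hindex in H. apply H.
  - apply Hx.
  - apply Hphi.
Qed.

(** * Contradiction with the governing hypothesis *)

(** Any natural number [k] above the constant [c] of the principal ideal works: otherwise
    [t <= c f_n <= k f_n < t]. *)
Lemma governs_not_ungoverned {X : NormedModule C_AbsRing} (T : X -> X)
    (f : nat -> R) (x : X) (phi : X -> C) :
  c0_nonneg f -> governs f (fun n => phi (Nat.iter n T x)) ->
  exists k, ~ ungoverned T f k x phi.
Proof.
  intros [_ Hf] [Hc0 [_ [c [Hc Hbound]]]].
  destruct (INR_unbounded c) as [k Hk]. exists k. intros [n [t [Ht Hcard]]].
  pose proof (rearrangement_ge _ n t (c0_bounded _ Hc0) Hcard) as Hre.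
  specialize (Hbound n). rewrite Cmod_R in Hbound. specialize (Hf n).
  pose proof (Rle_abs (rearrangement (fun k => Cmod (phi (Nat.iter k T x))) n)).
  nra.
Qed.

Theorem theorem3p2 (X : CompleteNormedModule C_AbsRing)
    (E : (X -> C) -> Prop) (T : X -> X) (f : nat -> R)
    (hE : dual_subspace E) (hEclosed : dual_closed E)
    (hEnorming : almost_norming E)
    (hT : is_linear T)
    (hf : c0_nonneg f)
    (hgov : forall (x : X) (phi : X -> C), E phi ->
       governs f (fun n => phi (Nat.iter n T x))) :
  Rbar_lt (spectral_radius T) 1.
Proof.
  apply NNPP. intros Hrad.
  destruct (ungoverned_exists E T f (complete_cauchy_complete X)
              hE hEclosed hEnorming hT hf Hrad) as [x [phi [HEphi Hun]]].
  destruct (governs_not_ungoverned T f x phi hf (hgov x phi HEphi)) as [k Hk].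
  exact (Hk (Hun k)).
Qed.
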